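(* For every $r\in(1,1.2)$ and every sufficiently large $N$, there exists a connected, undirected, edge-weighted graph $A_N$ on $N$ nodes such that \[ \rho^{\mathrm{Bd}}_r(A_N)>1.04\cdot\rho^{\mathrm{Bd}}_r(K_N)\quad\text{and}\quad \rho^{\mathrm{dB}}_r(A_N)>1.04\cdot\rho^{\mathrm{dB}}_r(K_N). \]
   Context: Each edge $\{u,v\}$ has a positive weight $w(u,v)$ and $\deg(u)=\sum_v w(u,v)$. Each node is occupied by a resident (fitness 1) or a mutant (fitness $r\ge1$); $f(u)$ is the fitness at $u$, $F=\sum_u f(u)$. Moran Birth-death (Bd) process: each step a node $u$ is chosen with probability $f(u)/F$ and its offspring replaces a neighbor $v$ chosen with probability $w(u,v)/\deg(u)$. Moran death-Birth (dB) process: each step a uniformly random node $v$ dies and is replaced by the offspring of a neighbor $u$ chosen with probability $f(u)w(u,v)/\sum_{u'}f(u')w(u',v)$. For a graph $G_N$ and process $p$, $\rho^p_r(G_N)=\frac1N\sum_{v}\rho^p_r(G_N,\{v\})$, where $\rho^p_r(G_N,\{v\})$ is the probability that mutants eventually occupy all nodes when initially only $v$ is a mutant. $K_N$ is the unweighted complete graph on $N$ nodes, for which $\rho^{\mathrm{Bd}}_r(K_N)=\frac{1-1/r}{1-1/r^N}$ and $\rho^{\mathrm{dB}}_r(K_N)=\frac{N-1}{N}\cdot\frac{1-1/r}{1-1/r^{N-1}}$. *)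

(* Defs.v *)
From HB Require Import structures.
From mathcomp Require Import all_boot all_order all_algebra.
From mathcomp Require Import all_classical all_reals all_analysis.
Set Implicit Arguments. Unset Strict Implicit. Unset Printing Implicit Defensive.
Import Order.TTheory GRing.Theory Num.Theory numFieldNormedType.Exports.
Local Open Scope ring_scope.

Section Moran.
Variables (R : realType) (N : nat).
Implicit Types (w : 'I_N -> 'I_N -> R) (S : {set 'I_N}).

(* An undirected edge-weighted graph on the nodes 'I_N: w u v > 0 iff
   {u,v} is an edge (with weight w u v); w u v = 0 otherwise.
   No self-loops. *)
Definition weighted_graph w :=
  [/\ forall u v, w u v = w v u, forall u v, 0 <= w u v & forall u, w u u = 0].

Definition adj w : rel 'I_N := fun u v => 0 < w u v.

Definition connected_graph w := forall u v, connect (adj w) u v.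

Definition wdeg w u : R := \sum_v w u v.

(* fitness: mutants (in S) have fitness r, residents 1 *)
Definition fit (r : R) S u : R := if u \in S then r else 1.

Definition repl S (u v : 'I_N) : {set 'I_N} :=
  if u \in S then v |: S else S :\ v.

Definition P_Bd w r S S' : R :=
  \sum_u \sum_v (fit r S u / \sum_x fit r S x) * (w u v / wdeg w u)
                 * (repl S u v == S')%:R.

Definition P_dB w r S S' : R :=
  \sum_v \sum_u (N%:R)^-1 * (fit r S u * w u v / \sum_x fit r S x * w x v)
                 * (repl S u v == S')%:R.


Fixpoint pfix (P : {set 'I_N} -> {set 'I_N} -> R) (k : nat) S : R :=
  match k with
  | 0 => (S == [set: 'I_N]%SET)%:R
  | k'.+1 => \sum_S' P S S' * pfix P k' S'
  end.

(* probability that mutants eventually occupy all nodes (setT is absorbing,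
   so this is the limit of the step-k probabilities) *)
Definition rho_from (P : {set 'I_N} -> {set 'I_N} -> R) S : R :=
  limn (fun k => pfix P k S).

Definition rho (P : {set 'I_N} -> {set 'I_N} -> R) : R :=
  (N%:R)^-1 * \sum_v rho_from P [set v].

Definition rho_Bd w r := rho (P_Bd w r).
Definition rho_dB w r := rho (P_dB w r).

Definition complete_w : 'I_N -> 'I_N -> R := fun u v => (u != v)%:R.

End Moran.

(* Main.v *)
(** A large clique (the hub) carries many pairs of nodes; the two nodes of a pair
    are joined by an edge of weight [b] and each is joined to every hub node by an
    edge of tiny weight [d].  Since [d] is tiny, pairs and hub are almost always
    homogeneous, and a mutant born in a pair takes over that pair with probability
    about 1/2.  A mutant hub is practically never lost, because a resident invades
    it with probability exponentially small in its size.  Hence everything depends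
    on whether a mutant pair conquers the resident hub before being reconquered by
    it.  Under Bd updating this is nearly certain when [b] is small compared with
    the hub degree (the pair sends much and receives little), under dB updating
    when [b] is large.  With 45% of the nodes in pairs of either kind, both
    fixation probabilities exceed 0.18, while on the complete graph they are at
    most about 1 - 1/r < 1/6.

    The lower bound is certified, for an initial mutant [j], by the submartingale
    p y_j + g (1 - th sum_u (1 - y_u) - p y_j), where [g] in [0, 1] measures the
    mutants in the hub and [y_u] in [0, 1] those in the pair of [u]; its drift is
    a sum over the edges joining mutants to residents, and is controlled edge by
    edge. *)

Require Import Defs.
From HB Require Import structures.
From mathcomp Require Import all_boot all_order all_algebra.
From mathcomp Require Import all_classical all_reals all_analysis.
From mathcomp Require Import zify ring lra.
From mathcomp Require Import fintype finset.
Set Implicit Arguments. Unset Strict Implicit. Unset Printing Implicit Defensive.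
Import Order.TTheory GRing.Theory Num.Theory numFieldNormedType.Exports.
Local Open Scope ring_scope.

(** * Fixation probabilities and (sub/super)harmonic functions *)

Lemma repl_setT N (u v : 'I_N) : repl [set: 'I_N] u v = [set: 'I_N].
Proof. by rewrite /repl inE; apply/setP => x; rewrite !inE orbT. Qed.

(* A move changes the state only along an edge joining a mutant to a resident. *)
Lemma sum_repl_cut (R : realType) N (a : 'I_N -> 'I_N -> R) (f : {set 'I_N} -> R)
    (S : {set 'I_N}) :
  \sum_u \sum_v a u v * (f (repl S u v) - f S) =
  \sum_(u in S) \sum_(v in ~: S)
    (a u v * (f (v |: S) - f S) + a v u * (f (S :\ u) - f S)).
Proof.
rewrite (bigID [in S]) /=.
have -> : \sum_(u in S) \sum_v a u v * (f (repl S u v) - f S) =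
          \sum_(u in S) \sum_(v in ~: S) a u v * (f (v |: S) - f S).
  apply: eq_bigr => u uS; rewrite (bigID [in ~: S]) /= [X in _ + X]big1.
    by rewrite addr0; apply: eq_bigr => v _; rewrite /repl uS.
  move=> v; rewrite inE negbK => vS; rewrite /repl uS.
  by rewrite (setUidPr _) ?sub1set // subrr mulr0.
have -> : \sum_(u | u \notin S) \sum_v a u v * (f (repl S u v) - f S) =
          \sum_(u in ~: S) \sum_(v in S) a u v * (f (S :\ v) - f S).
  apply: eq_big => [u|u uS]; first by rewrite inE.
  rewrite (bigID [in S]) /= [X in _ + X]big1.
    by rewrite addr0; apply: eq_bigr => v _; rewrite /repl (negbTE uS).
  move=> v vS; rewrite /repl (negbTE uS).
  by rewrite (setDidPl _) ?subrr ?mulr0 // disjoint_sym disjoints1.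
rewrite [X in _ + X]exchange_big -big_split /=.
by apply: eq_bigr => u _; rewrite -big_split.
Qed.

Section Kernel.
Variables (R : realType) (N : nat).
Variables (P : {set 'I_N} -> {set 'I_N} -> R) (a : {set 'I_N} -> 'I_N -> 'I_N -> R).
Hypothesis PE : forall S S',
  P S S' = \sum_u \sum_v a S u v * (repl S u v == S')%:R.
Hypothesis a_ge0 : forall S u v, 0 <= a S u v.
Hypothesis a_sum1 : forall S, \sum_u \sum_v a S u v = 1.

Lemma kernelE f S : \sum_S' P S S' * f S' = \sum_u \sum_v a S u v * f (repl S u v).
Proof.
under eq_bigr do rewrite PE big_distrl /=.
rewrite exchange_big /=; apply: eq_bigr => u _.
under eq_bigr do rewrite big_distrl /=.
rewrite exchange_big /=; apply: eq_bigr => v _.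
rewrite (bigD1 (repl S u v)) //= eqxx mulr1 big1 ?addr0 // => S' /negbTE.
by rewrite eq_sym => ->; rewrite mulr0 mul0r.
Qed.

Lemma kernel_driftE f S :
  \sum_S' P S S' * f S' - f S = \sum_u \sum_v a S u v * (f (repl S u v) - f S).
Proof.
rewrite kernelE -[X in _ - X = _]mul1r -[X in _ - X * _](a_sum1 S) big_distrl /= -sumrB.
apply: eq_bigr => u _; rewrite big_distrl /= -sumrB.
by apply: eq_bigr => v _; rewrite mulrBr.
Qed.

Lemma kernel_le f g S : (forall S, f S <= g S) ->
  \sum_S' P S S' * f S' <= \sum_S' P S S' * g S'.
Proof.
move=> fg; rewrite !kernelE; apply: ler_sum => u _; apply: ler_sum => v _.
exact: ler_wpM2l.
Qed.

Lemma kernel_cst c S : \sum_S' P S S' * c = c.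
Proof.
apply/eqP; rewrite -subr_eq0 (kernel_driftE (fun=> c)); apply/eqP.
by rewrite big1 // => u _; rewrite big1 // => v _; rewrite subrr mulr0.
Qed.

Lemma kernel_setT f : \sum_S' P [set: 'I_N] S' * f S' = f [set: 'I_N].
Proof.
rewrite kernelE; under eq_bigr do under eq_bigr do rewrite repl_setT.
by under eq_bigr do rewrite -mulr_suml; rewrite -mulr_suml a_sum1 mul1r.
Qed.

Lemma pfix_setT k : pfix P k [set: 'I_N] = 1.
Proof. by elim: k => [|k IH] /=; rewrite ?eqxx // kernel_setT. Qed.

Lemma pfix_ge0 k S : 0 <= pfix P k S.
Proof.
elim: k S => [|k IH] S /=; first exact: ler0n.
by rewrite -[leLHS](kernel_cst 0 S); apply: (@kernel_le (fun=> 0)).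
Qed.

Lemma pfix_le_super (psi : {set 'I_N} -> R) :
    (forall S, 0 <= psi S) -> 1 <= psi [set: 'I_N] ->
    (forall S, \sum_S' P S S' * psi S' <= psi S) ->
  forall k S, pfix P k S <= psi S.
Proof.
move=> psi0 psi1 psiP; elim=> [|k IH] S /=.
  by case: eqP => [->|_] //.
by apply: le_trans (psiP S); exact: kernel_le.
Qed.

Lemma pfix_le1 k S : pfix P k S <= 1.
Proof.
by apply: (@pfix_le_super (fun=> 1)) => // {}S; rewrite kernel_cst.
Qed.

Lemma pfix_nondecreasing S : {homo (fun k => pfix P k S) : n m / (n <= m)%N >-> n <= m}.
Proof.
have step k S0 : pfix P k S0 <= pfix P k.+1 S0.
  elim: k S0 => [|k IH] S0; last exact: kernel_le.
  rewrite [leLHS]/=; case: eqP => [->|_]; last exact: pfix_ge0.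
  by rewrite pfix_setT.
by apply: homo_leq => //; exact: le_trans.
Qed.

Lemma is_cvg_pfix S : cvgn (fun k => pfix P k S).
Proof.
apply: nondecreasing_is_cvgn; first exact: pfix_nondecreasing.
by exists 1 => _ [k _ <-]; exact: pfix_le1.
Qed.

Lemma rho_from_le psi S :
    (forall S, 0 <= psi S) -> 1 <= psi [set: 'I_N] ->
    (forall S, \sum_S' P S S' * psi S' <= psi S) ->
  rho_from P S <= psi S.
Proof.
move=> psi0 psi1 psiP; apply: limr_le; first exact: is_cvg_pfix.
by apply: nearW => k; exact: pfix_le_super.
Qed.

Lemma rho_from_ge0 S : 0 <= rho_from P S.
Proof.
apply: limr_ge; first exact: is_cvg_pfix.
by apply: nearW => k; exact: pfix_ge0.
Qed.

Lemma rho_from_setT : rho_from P [set: 'I_N] = 1.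
Proof.
rewrite /rho_from (_ : (fun k => _) = fun=> 1) ?lim_cst //.
by apply: funext => k; rewrite pfix_setT.
Qed.

Lemma rho_from_harmonic S : \sum_S' P S S' * rho_from P S' = rho_from P S.
Proof.
apply: (@cvg_unique _ (@Rhausdorff R) (fmap (fun k => pfix P k.+1 S) \oo%classic)).
  rewrite /=; apply: cvg_big; first exact: add_continuous.
  move=> S' _; apply: cvgMl_tmp; exact: is_cvg_pfix.
by have := is_cvg_pfix (S := S); rewrite -/(rho_from P S) -cvg_shiftS.
Qed.

(* Maximum principle: on the set where phi - rho is maximal, a state of largest
   cardinality could not move upwards, so it is absorbing. *)
Lemma rho_from_ge phi S0 :
    phi set0 <= 0 -> phi [set: 'I_N] <= 1 ->
    (forall S, phi S <= \sum_S' P S S' * phi S') ->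
    (forall S : {set 'I_N}, S != set0 -> S != [set: 'I_N] ->
       exists u v, [/\ u \in S, v \notin S & 0 < a S u v]) ->
  phi S0 <= rho_from P S0.
Proof.
move=> phi0 phi1 phiP move_up; pose D S := phi S - rho_from P S.
have DP S : D S <= \sum_S' P S S' * D S'.
  rewrite /D -[X in _ - X]rho_from_harmonic.
  under [leRHS]eq_bigr do rewrite mulrBr.
  by rewrite sumrB lerD2r.
suff : D S0 <= 0 by rewrite subr_le0.
rewrite leNgt; apply/negP => D0.
have [S1 _ S1max] := arg_maxP D (erefl (xpredT S0)).
have [S2 /eqP DS2 S2max] :=
  arg_maxnP (fun S : {set 'I_N} => #|S|) (eqxx (D S1) : [pred S | D S == D S1] S1).
have D2 : 0 < D S2 by rewrite DS2; exact: lt_le_trans D0 (S1max S0 isT).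
have Dle S : D S <= D S2 by rewrite DS2; exact: S1max.
have S2n0 : S2 != set0.
  apply: contraTneq D2 => ->; rewrite -leNgt /D.
  by have := rho_from_ge0 set0; lra.
have S2nT : S2 != [set: 'I_N].
  by apply: contraTneq D2 => ->; rewrite -leNgt /D rho_from_setT; lra.
have [u [v [uS vS auv]]] := move_up _ S2n0 S2nT.
have Dv : D (v |: S2) < D S2.
  rewrite lt_neqAle Dle andbT; apply/negP => /eqP Dv.
  have /= := S2max (v |: S2); rewrite Dv DS2 eqxx => /(_ isT).
  by rewrite cardsU1 vS add1n /= => *; lia.
have := DP S2; rewrite -subr_ge0 kernel_driftE.
rewrite leNgt => /negP; apply.
have term_le0 x y : a S2 x y * (D (repl S2 x y) - D S2) <= 0.
  by rewrite mulr_ge0_le0 // subr_le0.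
rewrite (bigD1 u) //= (bigD1 v) //=.
have h1 : a S2 u v * (D (repl S2 u v) - D S2) < 0.
  by rewrite /repl uS nmulr_llt0 // subr_lt0.
have h2 : \sum_(y < N | y != v) a S2 u y * (D (repl S2 u y) - D S2) <= 0.
  exact: sumr_le0.
have h3 : \sum_(x < N | x != u) \sum_(y < N) a S2 x y * (D (repl S2 x y) - D S2) <= 0.
  by apply: sumr_le0 => x _; exact: sumr_le0.
lra.
Qed.

End Kernel.

Definition rate_Bd (R : realType) N (w : 'I_N -> 'I_N -> R) r (S : {set 'I_N}) u v : R :=
  fit r S u * w u v / wdeg w u.

Definition rate_dB (R : realType) N (w : 'I_N -> 'I_N -> R) r (S : {set 'I_N}) u v : R :=
  fit r S u * w u v / \sum_x fit r S x * w x v.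

(* [c] are the replacement rates of [P] up to a state-dependent time change [z]. *)
Definition rate_kernel (R : realType) N (P : {set 'I_N} -> {set 'I_N} -> R)
    (c : {set 'I_N} -> 'I_N -> 'I_N -> R) :=
  exists z : {set 'I_N} -> R,
    [/\ forall S, 0 < z S,
        forall S u v, 0 <= c S u v,
        forall S, \sum_u \sum_v z S * c S u v = 1
      & forall S S', P S S' = \sum_u \sum_v z S * c S u v * (repl S u v == S')%:R].

Definition cut_drift (R : realType) N (c : 'I_N -> 'I_N -> R) (f : {set 'I_N} -> R)
    (S : {set 'I_N}) :=
  \sum_(u in S) \sum_(v in ~: S)
    (c u v * (f (v |: S) - f S) + c v u * (f (S :\ u) - f S)).

Section RateKernel.
Variables (R : realType) (N : nat) (P : {set 'I_N} -> {set 'I_N} -> R).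
Variable (c : {set 'I_N} -> 'I_N -> 'I_N -> R).
Hypothesis Pc : rate_kernel P c.

Lemma rate_kernel_drift f : exists2 z : {set 'I_N} -> R, (forall S, 0 < z S) &
  forall S, \sum_S' P S S' * f S' - f S = z S * cut_drift (c S) f S.
Proof.
have [z [z0 _ c1 PE]] := Pc; exists z => // S.
rewrite (kernel_driftE PE c1) sum_repl_cut mulr_sumr; apply: eq_bigr => u _.
by rewrite mulr_sumr; apply: eq_bigr => v _; ring.
Qed.

Lemma rho_from_le_cut psi S :
    (forall S, 0 <= psi S) -> 1 <= psi [set: 'I_N] ->
    (forall S, cut_drift (c S) psi S <= 0) ->
  rho_from P S <= psi S.
Proof.
move=> psi0 psi1 drift; have [z [z0 c0 c1 PE]] := Pc.
apply: (rho_from_le PE) => // [S1 u v|S1]; first by rewrite mulr_ge0 // ltW.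
have [z' z'0 E] := rate_kernel_drift psi.
by rewrite -subr_le0 E pmulr_rle0.
Qed.

Lemma rho_from_ge_cut phi S0 :
    phi set0 <= 0 -> phi [set: 'I_N] <= 1 ->
    (forall S, 0 <= cut_drift (c S) phi S) ->
    (forall S : {set 'I_N}, S != set0 -> S != [set: 'I_N] ->
       exists u v, [/\ u \in S, v \notin S & 0 < c S u v]) ->
  phi S0 <= rho_from P S0.
Proof.
move=> phi0 phi1 drift up; have [z [z0 c0 c1 PE]] := Pc.
apply: (rho_from_ge PE) => // [S u v|S|S S0' S1'].
- by rewrite mulr_ge0 // ltW.
- have [z' z'0 E] := rate_kernel_drift phi.
  by rewrite -subr_ge0 E pmulr_rge0.
- have [u [v [uS vS cuv]]] := up S S0' S1'.
  by exists u, v; rewrite mulr_gt0.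
Qed.

Lemma rho_from_ge0_rate S : 0 <= rho_from P S.
Proof.
have [z [z0 c0 c1 PE]] := Pc; apply: (rho_from_ge0 PE) => // S1 u v.
by rewrite mulr_ge0 // ltW.
Qed.

(* [r ^- #|S|] is a submartingale as soon as no resident-mutant edge is
   biased towards mutants by more than the factor [r]. *)
Lemma rho_le_unbiased r : 1 < r -> (0 < N)%N ->
    (forall (S : {set 'I_N}) u v, u \in S -> v \notin S -> c S u v <= r * c S v u) ->
  rho P <= (1 - r^-1) / (1 - r^-1 ^+ N).
Proof.
move=> r1 N0 c_le; set y := r^-1.
have r0 : 0 < r by lra.
have y0 : 0 < y by rewrite invr_gt0.
have y1 : y < 1 by rewrite invf_lt1.
have yN : 0 < 1 - y ^+ N by rewrite subr_gt0 exprn_ilt1 // ?ltW // -lt0n.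
pose psi (S : {set 'I_N}) := (1 - y ^+ #|S|) / (1 - y ^+ N).
have psiP S : rho_from P S <= psi S.
  apply: rho_from_le_cut => [{}S||{}S].
  - by rewrite divr_ge0 ?(ltW yN) // subr_ge0 exprn_ile1 // ltW.
  - by rewrite /psi cardsT card_ord divff // gt_eqF.
  - apply: sumr_le0 => u uS; apply: sumr_le0 => v; rewrite inE => vS.
    rewrite /psi cardsU1 vS add1n (cardsD1 u S) uS add1n.
    set k := #|_|; rewrite -mulrBl -[X in _ + _ * X]mulrBl.
    rewrite !mulrA -mulrDl pmulr_lle0 ?invr_gt0 //.
    have -> : c S u v * (1 - y ^+ k.+2 - (1 - y ^+ k.+1)) +
       c S v u * (1 - y ^+ k - (1 - y ^+ k.+1)) =
       (y ^+ k * (1 - y)) * (y * c S u v - c S v u) by rewrite !exprS; ring.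
    rewrite pmulr_rle0; last by rewrite mulr_gt0 ?exprn_gt0 ?subr_gt0.
    by rewrite subr_le0 ler_pdivrMl //; exact: c_le.
rewrite /rho ler_pdivrMl ?ltr0n // mulr_natl.
have <- : \sum_(v < N) (1 - y) / (1 - y ^+ N) = (1 - y) / (1 - y ^+ N) *+ N.
  by rewrite sumr_const card_ord.
by apply: ler_sum => v _; apply: le_trans (psiP _) _; rewrite /psi cards1 expr1.
Qed.

End RateKernel.

Section Processes.
Variables (R : realType) (N : nat) (w : 'I_N -> 'I_N -> R) (r : R).
Hypothesis w_graph : weighted_graph w.
Hypothesis deg_gt0 : forall u, 0 < wdeg w u.
Hypothesis r1 : 1 < r.
Hypothesis N0 : (0 < N)%N.

Lemma fit_ge1 (S : {set 'I_N}) u : 1 <= fit r S u :> R.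
Proof. by rewrite /fit; case: ifP => _ //; exact: ltW. Qed.

Lemma fit_gt0 (S : {set 'I_N}) u : 0 < fit r S u.
Proof. exact: lt_le_trans ltr01 (fit_ge1 S u). Qed.

Lemma fit_le (S : {set 'I_N}) u : fit r S u <= r.
Proof. by rewrite /fit; case: ifP => _ //; exact: ltW. Qed.

Lemma sum_fit_gt0 (S : {set 'I_N}) : 0 < \sum_x fit r S x.
Proof.
rewrite (bigD1 (Ordinal N0)) //= ltr_pwDl ?fit_gt0 //.
by apply: sumr_ge0 => x _; exact/ltW/fit_gt0.
Qed.

Lemma sum_fitw_gt0 S v : 0 < \sum_x fit r S x * w x v.
Proof.
apply: lt_le_trans (deg_gt0 v) _; apply: ler_sum => x _.
have [ws w0 _] := w_graph.
by rewrite ws ler_peMl ?fit_ge1.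
Qed.

Lemma rate_kernel_Bd : rate_kernel (P_Bd w r) (rate_Bd w r).
Proof.
have [ws w0 _] := w_graph.
exists (fun S => (\sum_x fit r S x)^-1); split.
- by move=> S; rewrite invr_gt0 sum_fit_gt0.
- by move=> S u v; rewrite divr_ge0 ?mulr_ge0 ?(ltW (fit_gt0 _ _)) // ltW.
- move=> S; under eq_bigr => u _.
    rewrite -mulr_sumr -mulr_suml -mulr_sumr mulfK ?gt_eqF ?deg_gt0 //.
    over.
  by rewrite -mulr_sumr mulVf ?gt_eqF ?sum_fit_gt0.
- move=> S S'; apply: eq_bigr => u _; apply: eq_bigr => v _.
  by rewrite /rate_Bd; ring.
Qed.

Lemma rate_kernel_dB : rate_kernel (P_dB w r) (rate_dB w r).
Proof.
have [ws w0 _] := w_graph.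
exists (fun=> N%:R^-1); split.
- by move=> S; rewrite invr_gt0 ltr0n.
- by move=> S u v; rewrite divr_ge0 ?mulr_ge0 ?(ltW (fit_gt0 _ _)) // ltW ?sum_fitw_gt0.
- move=> S; rewrite exchange_big /=; under eq_bigr => v _.
    rewrite -mulr_sumr -mulr_suml mulfV ?gt_eqF ?sum_fitw_gt0 // mulr1.
    over.
  by rewrite sumr_const card_ord -[LHS]mulr_natl mulfV // pnatr_eq0 -lt0n.
- move=> S S'; rewrite /P_dB exchange_big /=.
  by apply: eq_bigr => u _; apply: eq_bigr => v _; rewrite /rate_dB mulrA.
Qed.

Lemma connected_crossing (S : {set 'I_N}) : connected_graph w ->
  S != set0 -> S != [set: 'I_N] -> exists u v, [/\ u \in S, v \notin S & 0 < w u v].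
Proof.
move=> conn /set0Pn[x xS] SnT.
have /existsP[y yS] : [exists y, y \notin S].
  rewrite -negb_forall; apply: contra SnT => /forallP h.
  by apply/eqP/setP => z; rewrite h inE.
have [ws _ _] := w_graph.
case: (boolP [exists u, exists v, [&& u \in S, v \notin S & 0 < w u v]]).
  by move=> /existsP[u /existsP[v /and3P[]]]; exists u, v.
move=> /existsPn noedge.
suff cl : fingraph.closed (adj w) S by have := closed_connect cl (conn x y); rewrite xS (negbTE yS).
have half u v : adj w u v -> u \in S -> v \in S.
  move=> uv uS; move: (noedge u) => /existsPn/(_ v).
  by rewrite uS /=; rewrite /adj in uv; rewrite uv andbT negbK.
move=> u v uv; apply/idP/idP; first exact: half.
by apply: half; rewrite /adj ws.
Qed.

Lemma rho_from_Bd_ge phi S0 : connected_graph w ->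
    phi set0 <= 0 -> phi [set: 'I_N] <= 1 ->
    (forall S, 0 <= cut_drift (rate_Bd w r S) phi S) ->
  phi S0 <= rho_from (P_Bd w r) S0.
Proof.
move=> conn phi0 phi1 drift; apply: (rho_from_ge_cut rate_kernel_Bd) => // S Sn0 SnT.
have [u [v [uS vS wuv]]] := connected_crossing conn Sn0 SnT.
by exists u, v; rewrite divr_gt0 ?mulr_gt0 ?fit_gt0.
Qed.

Lemma rho_from_dB_ge phi S0 : connected_graph w ->
    phi set0 <= 0 -> phi [set: 'I_N] <= 1 ->
    (forall S, 0 <= cut_drift (rate_dB w r S) phi S) ->
  phi S0 <= rho_from (P_dB w r) S0.
Proof.
move=> conn phi0 phi1 drift; apply: (rho_from_ge_cut rate_kernel_dB) => // S Sn0 SnT.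
have [u [v [uS vS wuv]]] := connected_crossing conn Sn0 SnT.
by exists u, v; rewrite divr_gt0 ?mulr_gt0 ?fit_gt0 ?sum_fitw_gt0.
Qed.

End Processes.

Section CompleteGraph.
Variables (R : realType) (N : nat) (r : R).
Hypothesis N1 : (1 < N)%N.
Hypothesis r1 : 1 < r.

Lemma complete_weighted : weighted_graph (@complete_w R N).
Proof.
split=> [u v|u v|u]; rewrite /complete_w ?ler0n ?eqxx //.
by rewrite eq_sym.
Qed.

Lemma sum_complete (f : 'I_N -> R) v :
  \sum_x f x * complete_w R x v = \sum_x f x - f v.
Proof.
rewrite (bigD1 v) //= [in RHS](bigD1 v) //= /complete_w eqxx mulr0 add0r addrAC subrr add0r.
by apply: eq_bigr => x ->; rewrite mulr1.
Qed.

Lemma wdeg_complete u : wdeg (@complete_w R N) u = N%:R - 1.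
Proof.
have := sum_complete (fun=> 1) u; rewrite sumr_const card_ord => <-.
by apply: eq_bigr => x _; rewrite mul1r /complete_w eq_sym.
Qed.

Lemma wdeg_complete_gt0 u : 0 < wdeg (@complete_w R N) u.
Proof. by rewrite wdeg_complete subr_gt0 ltr1n. Qed.

Lemma rho_Bd_complete_le :
  rho_Bd (@complete_w R N) r <= (1 - r^-1) / (1 - r^-1 ^+ N).
Proof.
have N0 : (0 < N)%N by apply: leq_trans N1.
apply: (rho_le_unbiased (rate_kernel_Bd complete_weighted wdeg_complete_gt0 r1 N0)) => //.
move=> S u v uS vS.
rewrite /rate_Bd /fit uS (negbTE vS) !wdeg_complete mul1r.
by have [-> _ _] := complete_weighted; rewrite !mulrA.
Qed.

Lemma rho_dB_complete_le :
  rho_dB (@complete_w R N) r <= (1 - r^-1) / (1 - r^-1 ^+ N).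
Proof.
have N0 : (0 < N)%N by apply: leq_trans N1.
apply: (rho_le_unbiased (rate_kernel_dB complete_weighted wdeg_complete_gt0 r1 N0)) => //.
move=> S u v uS vS.
have uv : u != v by apply: contraNneq vS => <-.
have fu : fit r S u = r by rewrite /fit uS.
have fv : fit r S v = 1 by rewrite /fit (negbTE vS).
have F : r < \sum_x fit r S x.
  rewrite (bigD1 u) //= fu ltrDl (bigD1 v) 1?eq_sym //=.
  rewrite ltr_pwDl ?fit_gt0 //.
  by apply: sumr_ge0 => x _; exact/ltW/fit_gt0.
rewrite /rate_dB !sum_complete /complete_w uv eq_sym uv !mulr1 fu fv mul1r.
have r_gt1 := r1; rewrite ler_pM2l ?(lt_trans ltr01) //.
by rewrite lef_pV2 ?posrE; lra.
Qed.

End CompleteGraph.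

(** * The potential of a hub with pairs *)

Lemma sum_cut_ge0 (R : realType) N (S : {set 'I_N}) (t : 'I_N -> 'I_N -> R) eps u0 v0 :
    0 <= eps -> u0 \in S -> v0 \notin S -> N%:R ^+ 2 * eps <= t u0 v0 ->
    (forall u v, u \in S -> v \notin S -> - eps <= t u v) ->
  0 <= \sum_(u in S) \sum_(v in ~: S) t u v.
Proof.
move=> eps0 u0S v0S t0 t_ge.
have E : \sum_(u in S) \sum_(v in ~: S) t u v =
    \sum_(u in S) \sum_(v in ~: S) (t u v + eps) - #|S|%:R * (#|~: S|%:R * eps).
  under [in RHS]eq_bigr do rewrite big_split /= sumr_const -mulr_natl.
  by rewrite big_split /= sumr_const -[X in _ + X - _]mulr_natl addrK.
have nonneg u v : u \in S -> v \in ~: S -> 0 <= t u v + eps.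
  by rewrite inE => uS vS; have := t_ge _ _ uS vS; lra.
have v0C : v0 \in ~: S by rewrite inE.
have h1 : t u0 v0 + eps <= \sum_(u in S) \sum_(v in ~: S) (t u v + eps).
  rewrite (bigD1 u0) //= (bigD1 v0) //= -addrA lerDl addr_ge0 //.
    by apply: sumr_ge0 => v /andP[vS _]; exact: nonneg.
  by apply: sumr_ge0 => u /andP[uS _]; apply: sumr_ge0 => v; exact: nonneg.
have h2 : #|S|%:R * (#|~: S|%:R * eps) <= N%:R ^+ 2 * eps.
  rewrite mulrA ler_wpM2r // expr2 ler_pM ?ler0n // ler_nat.
    by rewrite -[leqRHS](card_ord N) max_card.
  by rewrite -[leqRHS](card_ord N) max_card.
by rewrite E; lra.
Qed.

Section Potential.
Variables (R : realType) (N : nat) (H : {set 'I_N}) (s : 'I_N -> 'I_N).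
Variables (x th : R) (j : 'I_N).
Hypotheses (sK : involutive s) (sH : forall u, (s u \in H) = (u \in H)).
Hypothesis s_neq : forall u, u \notin H -> s u != u.
Hypotheses (x0 : 0 < x) (x1 : x < 1).
Hypotheses (th0 : 0 <= th) (thN : th * N%:R <= 20^-1).
Hypotheses (H0 : (0 < #|H|)%N) (jH : j \notin H).
Implicit Types (S : {set 'I_N}) (u v : 'I_N).

(* 0, 12/25 or 1, according to whether the pair {u, s u} holds no, one or two
   mutants; 12/25 is slightly below the chance that a mixed pair becomes mutant. *)
Definition level S u : R :=
  12 / 25 * ((u \in S)%:R + (s u \in S)%:R) + 25^-1 * ((u \in S)%:R * (s u \in S)%:R).

Definition hub_level S : R := (1 - x ^+ #|S :&: H|) / (1 - x ^+ #|H|).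

Definition gap S : R :=
  1 - th * (\sum_(u in ~: H) (1 - level S u)) - 9 / 10 * level S j.

Definition potential S : R := 9 / 10 * level S j + hub_level S * gap S.

Definition influence S v : R :=
  (1 - hub_level S) * (9 / 10 * ((j == v) || (j == s v))%:R) + 2 * th * hub_level S.

Lemma level_ge0 S u : 0 <= level S u.
Proof. by rewrite /level; case: (u \in S); case: (s u \in S) => /=; lra. Qed.

Lemma level_le1 S u : level S u <= 1.
Proof. by rewrite /level; case: (u \in S); case: (s u \in S) => /=; lra. Qed.

Lemma deficit_bounds S : 0 <= th * (\sum_(u in ~: H) (1 - level S u)) <= 20^-1.
Proof.
apply/andP; split.
  rewrite mulr_ge0 ?th0 //; apply: sumr_ge0 => u _.
  by rewrite subr_ge0 level_le1.
apply: le_trans thN; rewrite ler_wpM2l ?th0 //.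
apply: (@le_trans _ _ (\sum_(u in ~: H) 1)).
  by apply: ler_sum => u _; rewrite gerBl level_ge0.
by rewrite sumr_const ler_nat -[leqRHS](card_ord N) max_card.
Qed.

Lemma gap_ge S : 20^-1 <= gap S.
Proof.
have /andP[_] := deficit_bounds S; rewrite /gap; set d := th * _ => d_le.
by have := level_le1 S j; lra.
Qed.

Lemma gap_le1 S : gap S <= 1.
Proof.
have /andP[+ _] := deficit_bounds S; rewrite /gap; set d := th * _ => d_ge.
by have := level_ge0 S j; lra.
Qed.

Lemma hub_den_gt0 : 0 < 1 - x ^+ #|H|.
Proof. by rewrite subr_gt0 exprn_ilt1 ?(ltW x0) // -lt0n. Qed.

Lemma hub_level_ge0 S : 0 <= hub_level S.
Proof.
by rewrite divr_ge0 ?(ltW hub_den_gt0) // subr_ge0 exprn_ile1 // ltW.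
Qed.

Lemma hub_level_le1 S : hub_level S <= 1.
Proof.
rewrite ler_pdivrMr ?hub_den_gt0 // mul1r lerD2l lerN2.
by rewrite ler_wiXn2l ?(ltW x0) ?(ltW x1) // subset_leq_card ?subsetIr.
Qed.

Lemma hub_level0 S : [disjoint S & H] -> hub_level S = 0.
Proof.
by move=> /disjoint_setI0; rewrite /hub_level => ->; rewrite cards0 expr0 subrr mul0r.
Qed.

Lemma hub_level1 S : H \subset S -> hub_level S = 1.
Proof. by move=> /setIidPr; rewrite /hub_level => ->; rewrite divff ?gt_eqF ?hub_den_gt0. Qed.

Lemma potential_ge0 S : 0 <= potential S.
Proof.
have := gap_ge S; have := level_ge0 S j; have := hub_level_ge0 S; rewrite /potential.
by move=> *; nra.
Qed.

Lemma potential_le1 S : potential S <= 1.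
Proof.
have g1 := hub_level_le1 S; have g0 := hub_level_ge0 S; have B := gap_ge S.
have /andP[+ _] := deficit_bounds S; rewrite /potential.
have : hub_level S * gap S <= gap S by rewrite ger_pMl //; lra.
rewrite {2}/gap; set d := th * _; lra.
Qed.

Lemma level_hub S u v : v \in H -> u \notin H -> level (v |: S) u = level S u.
Proof.
move=> vH uH; rewrite /level !in_setU1.
have -> : (u == v) = false by apply: contraNF uH => /eqP ->.
by have -> : (s u == v) = false by apply: contraNF uH => /eqP e; rewrite -sH e.
Qed.

Lemma gap_hub S v : v \in H -> gap (v |: S) = gap S.
Proof.
move=> vH; rewrite /gap level_hub //; congr (1 - th * _ - _).
by apply: eq_bigr => u; rewrite inE => uH; rewrite level_hub.
Qed.

Lemma potential_hub_add S v : v \in H -> v \notin S ->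
  potential (v |: S) - potential S =
  x ^+ #|S :&: H| * ((1 - x) / (1 - x ^+ #|H|)) * gap S.
Proof.
move=> vH vS; rewrite /potential gap_hub // level_hub // /hub_level.
have -> : (v |: S) :&: H = v |: (S :&: H).
  by apply/setP => u; rewrite !inE; case: eqP => [->|].
by rewrite cardsU1 inE (negbTE vS) add1n exprS; ring.
Qed.

Lemma potential_hub_del S u : u \in H -> u \in S ->
  potential (S :\ u) - potential S =
  - (x ^+ #|S :&: H|.-1 * ((1 - x) / (1 - x ^+ #|H|)) * gap S).
Proof.
move=> uH uS; have := @potential_hub_add (S :\ u) u uH; rewrite !inE eqxx => /(_ isT).
rewrite setD1K // -(gap_hub (S :\ u) uH) setD1K //.
have -> : #|(S :\ u) :&: H| = #|S :&: H|.-1.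
  by rewrite (cardsD1 u (S :&: H)) !inE uS uH add1n setIDAC.
by move=> <-; rewrite opprB.
Qed.

Lemma hub_level_pair S v : v \notin H -> hub_level (v |: S) = hub_level S.
Proof.
move=> vH; rewrite /hub_level; suff -> : (v |: S) :&: H = S :&: H by [].
by apply/setP => u; rewrite !inE; case: eqP => [->|] //; rewrite (negbTE vH) !andbF.
Qed.

Lemma level_pair S u v : v \notin H -> v \notin S -> u \notin H ->
  level (v |: S) u =
  level S u + ((u == v)%:R + (u == s v)%:R) * (12 / 25 + 25^-1 * (s v \in S)%:R).
Proof.
move=> vH vS uH; rewrite /level !in_setU1.
have -> : (s u == v) = (u == s v) by rewrite -(inj_eq (inv_inj sK)) sK.
case: (eqVneq u v) => [->|uv] /=.
  by rewrite eq_sym (negbTE (s_neq vH)) (negbTE vS) /=; case: (s v \in S) => /=; lra.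
case: (eqVneq u (s v)) => [->|usv] /=; last by rewrite addr0 mul0r addr0.
by rewrite sK (negbTE vS) /=; case: (s v \in S); rewrite /=; lra.
Qed.

Lemma sum_level_pair S v : v \notin H -> v \notin S ->
  \sum_(u in ~: H) (1 - level (v |: S) u) =
  \sum_(u in ~: H) (1 - level S u) - 2 * (12 / 25 + 25^-1 * (s v \in S)%:R).
Proof.
move=> vH vS; set dl := 12 / 25 + _.
have sum1 v' : v' \notin H -> \sum_(u in ~: H) (u == v')%:R * dl = dl.
  move=> v'H; rewrite (bigD1 v') ?inE //= eqxx mul1r big1 ?addr0 // => u /andP[_].
  by move=> /negbTE ->; rewrite mul0r.
have -> : 2 * dl = \sum_(u in ~: H) ((u == v)%:R + (u == s v)%:R) * dl.
  under eq_bigr do rewrite mulrDl.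
  by rewrite big_split /= !sum1 ?sH //; ring.
rewrite -sumrB; apply: eq_bigr => u; rewrite inE => uH.
by rewrite level_pair // -/dl; ring.
Qed.

Lemma potential_pair_add S v : v \notin H -> v \notin S ->
  potential (v |: S) - potential S =
  (12 / 25 + 25^-1 * (s v \in S)%:R) * influence S v.
Proof.
move=> vH vS; rewrite /potential /influence hub_level_pair // /gap sum_level_pair //.
rewrite level_pair //; set dl := 12 / 25 + _.
have -> : (j == v)%:R + (j == s v)%:R = ((j == v) || (j == s v))%:R :> R.
  case: (eqVneq j v) => [->|_] /=; last by rewrite add0r.
  by rewrite eq_sym (negbTE (s_neq vH)) addr0.
ring.
Qed.

Lemma potential_pair_del S u : u \notin H -> u \in S ->
  potential (S :\ u) - potential S =
  - ((12 / 25 + 25^-1 * (s u \in S)%:R) * influence S u).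
Proof.
move=> uH uS; have := @potential_pair_add (S :\ u) u uH; rewrite !inE eqxx => /(_ isT).
have -> : influence (S :\ u) u = influence S u.
  by rewrite /influence -(@hub_level_pair (S :\ u) u) // setD1K.
by rewrite setD1K // s_neq //= => <-; rewrite opprB.
Qed.

Lemma influence_ge0 S v : 0 <= influence S v.
Proof.
have g0 := hub_level_ge0 S; have g1 := hub_level_le1 S.
have h := th0; rewrite /influence addr_ge0 //; last by apply: mulr_ge0 => //; lra.
by apply: mulr_ge0; [lra|case: (_ || _) => /=; lra].
Qed.

Lemma influence_s S v : influence S (s v) = influence S v.
Proof. by rewrite /influence sK orbC. Qed.

Lemma hub_step_ge : 1 - x <= (1 - x) / (1 - x ^+ #|H|).
Proof.
rewrite ler_pdivlMr ?hub_den_gt0 //.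
have h1 := x1; have : 0 <= x ^+ #|H| by rewrite exprn_ge0 // ltW.
by nra.
Qed.

Lemma hub_step_le1 : (1 - x) / (1 - x ^+ #|H|) <= 1.
Proof.
rewrite ler_pdivrMr ?hub_den_gt0 // mul1r lerD2l lerN2 -[leRHS]expr1.
by rewrite ler_wiXn2l ?(ltW x0) ?(ltW x1).
Qed.

Lemma potential_add_ge0 S v : v \notin S -> 0 <= potential (v |: S) - potential S.
Proof.
move=> vS; have [vH|vH] := boolP (v \in H).
  rewrite potential_hub_add // mulr_ge0 //; last by have := gap_ge S; lra.
  rewrite mulr_ge0 ?exprn_ge0 ?(ltW x0) //; apply: le_trans hub_step_ge.
  by rewrite subr_ge0 ltW.
by rewrite potential_pair_add // mulr_ge0 ?influence_ge0.
Qed.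

Section Drift.
Variables (S : {set 'I_N}) (c : 'I_N -> 'I_N -> R) (eps eH eP : R).
Hypotheses (eps0 : 0 <= eps) (eH0 : 0 <= eH) (eP0 : 0 <= eP).
Hypothesis eps_hub : N%:R ^+ 2 * eps <= 20^-1 * (1 - x) * x ^+ #|H| * eH.
Hypothesis eps_seed : N%:R ^+ 2 * eps <= 9 / 10 * eP.
Hypothesis eps_guard : N%:R ^+ 2 * eps <= 2 * th * eP.
Hypothesis c_ge0 : forall u v, 0 <= c u v.
Hypothesis c_far : forall u v, u \notin H -> v \notin H -> v != s u -> c u v = 0.
Hypothesis c_ext : forall u v, (u \in H) != (v \in H) -> c u v <= eps.
Hypothesis c_hub : forall u v, u \in H -> v \in H -> u \in S -> v \notin S ->
  c v u + eH <= x * c u v.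
Hypothesis c_pair : forall u, u \notin H -> u \in S -> s u \notin S ->
  12 / 25 * c (s u) u + eP <= 13 / 25 * c u (s u).
Hypothesis c_seed : forall u v, [disjoint S & H] -> j \in S -> s j \in S ->
  (j == u) || (j == s u) -> v \in H -> 9 / 10 * (13 / 25) * c v u <= 20^-1 * (1 - x) * c u v.
Hypothesis c_guard : forall u v, H \subset S -> u \in H -> v \notin H ->
  v \notin S -> s v \notin S -> x ^+ #|H|.-1 * c v u <= 24 / 25 * th * c u v.

Local Notation term u v :=
  (c u v * (potential (v |: S) - potential S) + c v u * (potential (S :\ u) - potential S)).

Lemma term_hub u v : u \in H -> v \in H -> u \in S -> v \notin S ->
  20^-1 * (1 - x) * x ^+ #|H| * eH <= term u v.
Proof.
move=> uH vH uS vS; rewrite potential_hub_add // potential_hub_del //.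
have : (0 < #|S :&: H|)%N by apply/card_gt0P; exists u; rewrite inE uS.
have : (#|S :&: H| <= #|H|)%N by rewrite subset_leq_card ?subsetIr.
case: #|S :&: H| => // i iH _ /=; set K := _ / _.
have -> : c u v * (x ^+ i.+1 * K * gap S) + c v u * - (x ^+ i * K * gap S) =
    gap S * K * x ^+ i * (x * c u v - c v u) by rewrite exprS; ring.
have gS := gap_ge S; have KP := hub_step_ge; rewrite -/K in KP.
have xx1 := x1; have hx : x ^+ #|H| <= x ^+ i.
  by rewrite ler_wiXn2l ?(ltW x0) ?(ltW x1) // ltnW.
have hx0 : 0 <= x ^+ #|H| by rewrite exprn_ge0 // ltW.
have hc := c_hub uH vH uS vS.
apply: ler_pM => //; [| |lra].
- by rewrite mulr_ge0 // mulr_ge0 //; lra.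
- by apply: ler_pM => //; [rewrite mulr_ge0 //; lra|apply: ler_pM => //; lra].
Qed.

Lemma term_pair u : u \notin H -> u \in S -> s u \notin S ->
  influence S u * eP <= term u (s u).
Proof.
move=> uH uS suS; rewrite potential_pair_add ?sH // potential_pair_del // sK uS.
rewrite (negbTE suS) influence_s /=.
have hc := c_pair uH uS suS; have i0 := influence_ge0 S u.
have -> : c u (s u) * ((12 / 25 + 25^-1 * 1) * influence S u) +
   c (s u) u * - ((12 / 25 + 25^-1 * 0) * influence S u) =
   influence S u * (13 / 25 * c u (s u) - 12 / 25 * c (s u) u) by field.
by rewrite ler_wpM2l //; lra.
Qed.

Lemma term_internal_ge0 u v : u \in S -> v \notin S -> (u \in H) = (v \in H) ->
  0 <= term u v.
Proof.
move=> uS vS; have [vH uH|vH uH] := boolP (v \in H).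
  apply: le_trans (term_hub uH vH uS vS); rewrite mulr_ge0 // mulr_ge0 //.
    by have h := x1; lra.
  by rewrite exprn_ge0 // ltW.
have [E|vsu] := eqVneq v (s u).
  rewrite E in vS *; apply: le_trans (term_pair _ uS vS); rewrite ?uH //.
  by rewrite mulr_ge0 ?influence_ge0.
have usv : u != s v by apply: contraNneq vsu => ->; rewrite sK.
by rewrite !c_far ?uH // !mul0r addr0.
Qed.

Lemma term_ge u v : u \in S -> v \notin S -> - eps <= term u v.
Proof.
move=> uS vS; have [E|E] := eqVneq (u \in H) (v \in H).
  by apply: le_trans (term_internal_ge0 uS vS E); rewrite oppr_le0.
have cvu : c v u <= eps by apply: c_ext; rewrite eq_sym.
have h1 : 0 <= c u v * (potential (v |: S) - potential S).
  by rewrite mulr_ge0 ?potential_add_ge0.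
have h2 : - eps <= c v u * (potential (S :\ u) - potential S).
  have h3 := potential_le1 S; have h4 := potential_ge0 (S :\ u).
  have h5 : c v u * -1 <= c v u * (potential (S :\ u) - potential S).
    by rewrite ler_wpM2l //; lra.
  by lra.
lra.
Qed.

Lemma drift_ge0_of_term u v : u \in S -> v \notin S -> N%:R ^+ 2 * eps <= term u v ->
  0 <= cut_drift c potential S.
Proof. by move=> uS vS E; apply: (sum_cut_ge0 eps0 uS vS E); exact: term_ge. Qed.

Lemma drift_ge0_of_terms : (forall u v, u \in S -> v \notin S -> (u \in H) != (v \in H) ->
  0 <= term u v) -> 0 <= cut_drift c potential S.
Proof.
move=> ge0; apply: sumr_ge0 => u uS; apply: sumr_ge0 => v; rewrite inE => vS.
have [E|E] := eqVneq (u \in H) (v \in H); first exact: term_internal_ge0.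
exact: ge0.
Qed.

Lemma drift_resident_hub : [disjoint S & H] -> 0 <= cut_drift c potential S.
Proof.
move=> dis; have g0 := hub_level0 dis.
have notH u : u \in S -> u \notin H by move=> uS; rewrite (disjointFr dis uS).
have mixed u : (j == u) || (j == s u) -> u \in S -> s u \notin S ->
    0 <= cut_drift c potential S.
  move=> ju uS suS; apply: (drift_ge0_of_term uS suS).
  apply: le_trans (term_pair (notH _ uS) uS suS).
  by rewrite /influence g0 ju mulr0 addr0 subr0 mul1r mulr1.
have [jS|jS] := boolP (j \in S); have [sjS|sjS] := boolP (s j \in S).
- apply: drift_ge0_of_terms => u v uS vS; rewrite (negbTE (notH _ uS)).
  have [vH _|//] := boolP (v \in H).
  rewrite potential_hub_add // potential_pair_del ?notH //.
  rewrite (disjoint_setI0 dis) cards0 expr0 mul1r.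
  rewrite /influence g0 mulr0 addr0 subr0 mul1r.
  have gS := gap_ge S; have KP := hub_step_ge; have xx1 := x1.
  set K := (1 - x) / (1 - x ^+ #|H|) in KP *.
  have h : 20^-1 * (1 - x) * c u v <= c u v * (K * gap S).
    rewrite mulrC ler_wpM2l // mulrC ler_pM //; lra.
  have [ju|ju] := boolP ((j == u) || (j == s u)); last first.
    rewrite /= !mulr0 oppr0 mulr0 addr0; apply: le_trans h.
    by rewrite mulr_ge0 // mulr_ge0 //; lra.
  have -> : s u \in S by case/orP: ju => /eqP e; rewrite -?e // e sK in sjS *.
  by have := c_seed dis jS sjS ju vH; rewrite /=; lra.
- by apply: (mixed j); rewrite ?eqxx.
- by apply: (mixed (s j)); rewrite ?sK ?eqxx ?orbT.
- apply: sumr_ge0 => u uS; apply: sumr_ge0 => v _.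
  have -> : potential S = 0.
    by rewrite /potential g0 /level (negbTE jS) (negbTE sjS) /=; ring.
  by rewrite !subr0 addr_ge0 // mulr_ge0 ?potential_ge0.
Qed.

Lemma drift_mutant_hub : H \subset S -> 0 <= cut_drift c potential S.
Proof.
move=> HS; have g1 := hub_level1 HS.
have influE u : influence S u = 2 * th.
  by rewrite /influence g1 subrr mul0r add0r mulr1.
have notH v : v \notin S -> v \notin H by apply: contra => /(subsetP HS).
have [/existsP[u /and3P[uH uS suS]]|/existsPn nomix] :=
  boolP [exists u, [&& u \notin H, u \in S & s u \notin S]].
  apply: (drift_ge0_of_term uS suS); apply: le_trans (term_pair uH uS suS).
  by rewrite influE.
apply: drift_ge0_of_terms => u v uS vS; rewrite (negbTE (notH _ vS)).
have [uH _|//] := boolP (u \in H).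
have vH := notH _ vS.
have svS : s v \notin S.
  by apply/negP => svS; have := nomix (s v); rewrite sH vH svS sK vS.
rewrite potential_pair_add // potential_hub_del // (negbTE svS) influE.
rewrite (setIidPr HS); set K := (1 - x) / (1 - x ^+ #|H|).
have hc := c_guard HS uH vH vS svS.
have K0 : 0 <= K.
  by have h := hub_step_ge; have xx1 := x1; rewrite -/K in h; lra.
have h : c v u * (x ^+ #|H|.-1 * K * gap S) <= x ^+ #|H|.-1 * c v u.
  have xc : 0 <= x ^+ #|H|.-1 * c v u by rewrite mulr_ge0 // exprn_ge0 // ltW.
  have -> : c v u * (x ^+ #|H|.-1 * K * gap S) = x ^+ #|H|.-1 * c v u * (K * gap S).
    by ring.
  rewrite ler_piMr // mulr_ile1 ?gap_le1 ?hub_step_le1 //.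
  by have := gap_ge S; lra.
rewrite mulrN; set A := c v u * _ in h *; rewrite /=.
have -> : c u v * ((12 / 25 + 25^-1 * 0) * (2 * th)) = 24 / 25 * th * c u v by field.
lra.
Qed.

Lemma drift_ge0 : 0 <= cut_drift c potential S.
Proof.
have [HS|/subsetPn[v vH vS]] := boolP (H \subset S); first exact: drift_mutant_hub.
have [dis|] := boolP [disjoint S & H]; first exact: drift_resident_hub.
rewrite -setI_eq0 => /set0Pn[u]; rewrite inE => /andP[uS uH].
by apply: (drift_ge0_of_term uS vS); apply: le_trans (term_hub uH vH uS vS).
Qed.

End Drift.

End Potential.

(** * The weighted graph *)

Lemma ratio_le (R : realType) (a m D : R) : 0 <= a -> 0 < m -> m <= D -> a / D <= a / m.
Proof.
move=> a0 m0 mD; rewrite ler_wpM2l // lef_pV2 ?posrE //.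
exact: lt_le_trans mD.
Qed.

(* In the inequalities below [D] and [E] stand for the total weights seen by a hub
   node and by a node of a pair. *)
Section RateInequalities.
Variable R : realType.
Implicit Types r x y d h D E M T X : R.

Lemma hub_edge_Bd r x D M : 1 < r -> r * x = (r + 1) / 2 -> 0 < D -> D <= M -> 1 <= M ->
  1 / D + (r - 1) / (20 * M ^+ 2) <= x * (r / D).
Proof.
move=> r1 rx D0 DM M1; rewrite mulrA [x * r]mulrC rx.
have -> : (r + 1) / 2 / D = 1 / D + (r - 1) / (2 * D) by field; lra.
by rewrite lerD2l; apply: ratio_le; [lra|lra|nra].
Qed.

Lemma hub_edge_dB r x T M : 1 < r -> r < 6 / 5 -> r * x = (r + 1) / 2 ->
  4 <= T -> T <= 2 * M ->
  1 / (T - r) + (r - 1) / (20 * M ^+ 2) <= x * (r / (T - 1)).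
Proof.
move=> r1 r2 rx T1 T2; rewrite mulrA [x * r]mulrC rx -lerBrDl.
have -> : (r + 1) / 2 / (T - 1) - 1 / (T - r) =
  (r - 1) * (T - r - 2) / (2 * ((T - 1) * (T - r))) by field; lra.
have T3 : 0 < (T - 1) * (T - r) by apply: mulr_gt0; lra.
have M0 : 0 < M ^+ 2 by rewrite exprn_gt0 //; lra.
rewrite ler_pdivrMr; last lra.
rewrite [leRHS]mulrAC ler_pdivlMr; last lra.
rewrite -!mulrA ler_wpM2l //; first lra.
have h1 : (T - 1) * (T - r) <= (2 * M) ^+ 2 by nra.
have h2 : M ^+ 2 * (4 / 5) <= M ^+ 2 * (T - r - 2).
  by rewrite ler_wpM2l ?exprn_ge0 //; lra.
by lra.
Qed.

Lemma seed_edge_Bd r y d D E : 1 < r -> 0 < d -> 0 < y -> 3 <= D ->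
  0 < E -> E <= y * (21 / 200) -> 10 * (1 * d / D) <= y * (r * d / E).
Proof.
move=> r1 d0 y0 D3 E0 EE.
have h1 : 1 * d / D <= 1 * d / 3 by apply: ratio_le; lra.
have h2 : r * d / (y * (21 / 200)) <= r * d / E by apply: ratio_le; [nra|lra|lra].
have h3 : y * (r * d / (y * (21 / 200))) = 200 / 21 * (r * d) by field; lra.
have h4 : y * (r * d / (y * (21 / 200))) <= y * (r * d / E) by rewrite ler_wpM2l // ltW.
by apply: le_trans h4; rewrite h3; nra.
Qed.

Lemma seed_edge_dB r y d h D E : 1 < r -> 0 < d -> 0 < y -> 0 < h ->
  10 * h / y <= E -> 0 < D -> D <= h -> 10 * (1 * d / E) <= y * (r * d / D).
Proof.
move=> r1 d0 y0 h0 EE D0 Dh.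
have b0 : 0 < 10 * h / y by rewrite divr_gt0 //; lra.
have h1 : 1 * d / E <= 1 * d / (10 * h / y) by apply: ratio_le; lra.
have h2 : r * d / h <= r * d / D by apply: ratio_le; [nra|lra|lra].
apply: (@le_trans _ _ (y * (r * d / h))); last by rewrite ler_wpM2l // ltW.
have -> : y * (r * d / h) = r * (y * d / h) by field; lra.
have E1 : 10 * (1 * d / (10 * h / y)) = y * d / h by field; lra.
have : 0 <= y * d / h by rewrite divr_ge0 ?mulr_ge0 // ltW.
by nra.
Qed.

Lemma guard_edge_Bd r y d D E M X : 1 < r -> 0 < d -> 0 < y -> 0 < M -> 0 <= X ->
  250 * M ^+ 2 * X <= y -> y / 10 <= E -> 0 < D -> D <= M ->
  X * (d / E) <= 24 / 25 * (20 * M)^-1 * (r * d / D).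
Proof.
move=> r1 d0 y0 M0 X0 NL EE D0 DM.
have h1 : d / E <= d / (y / 10) by apply: ratio_le; lra.
have h2 : r * d / M <= r * d / D by apply: ratio_le; [nra|lra|lra].
have MM0 : 0 < M ^+ 2 by rewrite exprn_gt0.
apply: (@le_trans _ _ (X * (d / (y / 10)))); first exact: ler_wpM2l.
apply: (@le_trans _ _ (24 / 25 * (20 * M)^-1 * (r * d / M))); last first.
  by rewrite ler_wpM2l // mulr_ge0 ?invr_ge0 //; lra.
have -> : 24 / 25 * (20 * M)^-1 * (r * d / M) = 12 / 250 * r * d / (M ^+ 2).
  by field; lra.
have -> : X * (d / (y / 10)) = 10 * X * d / y by field; lra.
rewrite ler_pdivrMr // [leRHS]mulrAC ler_pdivlMr //.
have h3 : d * (250 * M ^+ 2 * X) <= d * y by rewrite ler_wpM2l // ltW.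
have h5 : 0 <= d * y by rewrite mulr_ge0 // ltW.
have h4 : d * y <= r * (d * y) by rewrite ler_peMl //; lra.
by lra.
Qed.

Lemma guard_edge_dB r y d D E M X : 1 < r -> 0 < d -> 0 < y -> 0 < M -> 0 <= X ->
  250 * M ^+ 2 * X <= y -> 2 <= D -> 0 < E -> E <= 11 * M / y ->
  X * (d / D) <= 24 / 25 * (20 * M)^-1 * (r * d / E).
Proof.
move=> r1 d0 y0 M0 X0 NL D2 E0 EE.
have h1 : d / D <= d / 2 by apply: ratio_le; lra.
have h2 : r * d / (11 * M / y) <= r * d / E by apply: ratio_le; [nra|lra|lra].
have MM0 : 0 < M ^+ 2 by rewrite exprn_gt0.
apply: (@le_trans _ _ (X * (d / 2))); first exact: ler_wpM2l.
apply: (@le_trans _ _ (24 / 25 * (20 * M)^-1 * (r * d / (11 * M / y)))); last first.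
  by rewrite ler_wpM2l // mulr_ge0 ?invr_ge0 //; lra.
have -> : 24 / 25 * (20 * M)^-1 * (r * d / (11 * M / y)) =
  12 / 2750 * r * d * y / (M ^+ 2) by field; lra.
rewrite ler_pdivlMr //.
have h3 : d * (250 * M ^+ 2 * X) <= d * y by rewrite ler_wpM2l // ltW.
have h5 : 0 <= d * y by rewrite mulr_ge0 // ltW.
have h4 : d * y <= r * (d * y) by rewrite ler_peMl //; lra.
by lra.
Qed.

End RateInequalities.

Section Wheel.
Variables (R : realType) (N : nat) (H : {set 'I_N}) (s : 'I_N -> 'I_N).
Variables (b : 'I_N -> R) (d r : R).
Implicit Types (S : {set 'I_N}) (u v : 'I_N).

Definition wheel_w u v : R :=
  if u \in H then if v \in H then (u != v)%:R else d
  else if v \in H then d else (v == s u)%:R * b u.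

Hypotheses (sK : involutive s) (sH : forall u, (s u \in H) = (u \in H)).
Hypothesis s_neq : forall u, u \notin H -> s u != u.
Hypothesis bs : forall u, b (s u) = b u.
Hypotheses (b_gt0 : forall u, 0 < b u) (d_gt0 : 0 < d).
Hypothesis H2 : (1 < #|H|)%N.

Lemma wheel_weighted : weighted_graph wheel_w.
Proof.
split=> [u v|u v|u]; rewrite /wheel_w.
- have [uH|uH] := boolP (u \in H); have [vH|vH] := boolP (v \in H) => //.
    by rewrite eq_sym.
  have -> : (u == s v) = (v == s u) by apply/eqP/eqP => ->; rewrite sK.
  by case: eqP => [->|]; rewrite ?mul0r ?bs.
- case: ifP => _; case: ifP => _; rewrite ?ler0n ?(ltW d_gt0) //.
  by rewrite mulr_ge0 ?ler0n ?(ltW (b_gt0 _)).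
- have [uH|uH] := boolP (u \in H); first by rewrite eqxx.
  by rewrite eq_sym (negbTE (s_neq uH)) mul0r.
Qed.

Lemma wheel_connected : connected_graph wheel_w.
Proof.
have /card_gt0P[z zH] : (0 < #|H|)%N by apply: leq_trans H2.
have [ws _ _] := wheel_weighted.
have uz u : u != z -> 0 < wheel_w u z.
  move=> uNz; rewrite /wheel_w zH uNz; case: ifP => _ //.
have cz u : connect (adj wheel_w) u z /\ connect (adj wheel_w) z u.
  have [->|uNz] := eqVneq u z; first by rewrite !connect0.
  by split; apply: connect1; rewrite /adj 1?[wheel_w z u]ws uz.
by move=> u v; apply: connect_trans (cz u).1 (cz v).2.
Qed.

Lemma wheel_sum_hub (f : 'I_N -> R) v : v \in H ->
  \sum_x f x * wheel_w x v = \sum_(x in H) f x - f v + d * \sum_(x in ~: H) f x.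
Proof.
move=> vH; rewrite (bigID [in H]) /=; congr (_ + _).
  rewrite (bigD1 v) //= [in RHS](bigD1 v) //= /wheel_w vH eqxx mulr0 add0r.
  rewrite addrAC subrr add0r; apply: eq_bigr => x /andP[-> ->].
  by rewrite mulr1.
rewrite mulr_sumr; apply: eq_big => [x|x xH]; first by rewrite inE.
by rewrite /wheel_w (negbTE xH) vH mulrC.
Qed.

Lemma wheel_sum_pair (f : 'I_N -> R) v : v \notin H ->
  \sum_x f x * wheel_w x v = d * (\sum_(x in H) f x) + f (s v) * b v.
Proof.
move=> vH; rewrite (bigID [in H]) /=; congr (_ + _).
  rewrite mulr_sumr; apply: eq_bigr => x xH.
  by rewrite /wheel_w xH (negbTE vH) mulrC.
rewrite (bigD1 (s v)) /= ?sH // {1}/wheel_w sH (negbTE vH) sK eqxx mul1r bs.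
rewrite big1 ?addr0 // => x /andP[xH xv].
rewrite /wheel_w (negbTE xH) (negbTE vH).
have -> : (v == s x) = false; last by rewrite mul0r mulr0.
by apply: contraNF xv => /eqP ->; rewrite sK.
Qed.

Lemma wheel_deg_hub u : u \in H -> wdeg wheel_w u = #|H|%:R - 1 + d * #|~: H|%:R.
Proof.
move=> uH; have [ws _ _] := wheel_weighted.
rewrite -!sumr_const -(wheel_sum_hub (fun=> 1) uH); apply: eq_bigr => x _.
by rewrite mul1r ws.
Qed.

Lemma wheel_deg_pair u : u \notin H -> wdeg wheel_w u = d * #|H|%:R + b u.
Proof.
move=> uH; have [ws _ _] := wheel_weighted.
rewrite -sumr_const -[b u]mul1r -(wheel_sum_pair (fun=> 1) uH); apply: eq_bigr => x _.
by rewrite mul1r ws.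
Qed.

Lemma wheel_deg_gt0 u : 0 < wdeg wheel_w u.
Proof.
have h1 : 1 < #|H|%:R :> R by rewrite ltr1n.
have [uH|uH] := boolP (u \in H).
  rewrite wheel_deg_hub // ltr_pwDl ?subr_gt0 // mulr_ge0 ?ler0n // ltW //.
by rewrite wheel_deg_pair // ltr_wpDl // mulr_ge0 ?ler0n // ltW.
Qed.

(* The midpoint of 1/r and 1, so that [- hub_ratio ^+ i] has a strictly positive
   drift while the hub holds both residents and mutants. *)
Definition hub_ratio : R := (1 + r^-1) / 2.
Local Notation x := hub_ratio.
Local Notation h := (#|H|%:R : R).
Local Notation n := (#|~: H|%:R : R).
Local Notation th := (20 * N%:R : R)^-1.

Hypotheses (r_gt1 : 1 < r) (r_lt : r < 6 / 5) (H4 : (3 < #|H|)%N).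
Hypothesis b_ge : forall u, (1 - x) / 10 <= b u.
Hypothesis b_le : forall u, b u <= 10 * h / (1 - x).
Hypothesis d_pair : 20 * (N%:R * d) <= (1 - x) / 10.
Hypothesis d_hub : N%:R ^+ 2 * (20 * d / (1 - x)) <=
  20^-1 * (1 - x) * x ^+ #|H| * ((r - 1) / (20 * N%:R ^+ 2)).
Hypothesis d_guard : N%:R ^+ 2 * (20 * d / (1 - x)) <= 2 * th * 100^-1.
Hypothesis N_large : 250 * N%:R ^+ 2 * x ^+ #|H|.-1 <= 1 - x.

Lemma hub_ratioE : r * x = (r + 1) / 2.
Proof. by rewrite /hub_ratio; field; have := r_gt1; lra. Qed.

Lemma hub_ratio_bounds : [/\ 0 < x, x < 1 & 1 - x < 12^-1].
Proof. by have E := hub_ratioE; have := r_gt1; have := r_lt; split; nra. Qed.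

Lemma wheel_sizes : [/\ 4 <= h, 0 <= n, h + n = N%:R, d * h <= (1 - x) / 200
  & d * n <= (1 - x) / 200].
Proof.
have h4 : 4 <= h by rewrite ler_nat.
have n0 : 0 <= n by rewrite ler0n.
have E : h + n = N%:R by rewrite -natrD cardsC card_ord.
have := d_pair; rewrite -E => dp; have d0 := d_gt0.
have dh : 0 <= d * h by apply: mulr_ge0; lra.
have dn : 0 <= d * n by apply: mulr_ge0; lra.
by split=> //; lra.
Qed.

Lemma th_bounds : [/\ 0 <= th, th * N%:R <= 20^-1 & 2 * th * 100^-1 <= 9 / 10 * 100^-1].
Proof.
have [h4 n0 E _ _] := wheel_sizes; have N4 : 4 <= N%:R :> R by lra.
have T : th * N%:R = 20^-1 by field; lra.
have th0 : 0 <= th by rewrite invr_ge0 mulr_ge0.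
by split; [|rewrite T|nra].
Qed.

Lemma sum_fit_bounds S (A : {set 'I_N}) :
  #|A|%:R <= \sum_(u in A) fit r S u <= r * #|A|%:R.
Proof.
rewrite -[X in X <= _]sumr_const mulr_natr -sumr_const.
by rewrite !ler_sum // => u _; rewrite ?fit_ge1 ?fit_le.
Qed.

Lemma potential_seed j : j \notin H -> potential H s x th j [set j] = 54 / 125.
Proof.
move=> jH; rewrite /potential hub_level0; last by rewrite disjoints1.
by rewrite mul0r addr0 /level !inE eqxx (negbTE (s_neq jH)) /=; lra.
Qed.

Lemma potential_set0 j : potential H s x th j set0 <= 0.
Proof.
rewrite /potential hub_level0; last by rewrite -setI_eq0 set0I.
by rewrite mul0r addr0 /level !inE /=; lra.
Qed.

Lemma wheel_drift j S c : j \notin H ->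
    (forall u v, 0 <= c u v) ->
    (forall u v, u \notin H -> v \notin H -> v != s u -> c u v = 0) ->
    (forall u v, (u \in H) != (v \in H) -> c u v <= 20 * d / (1 - x)) ->
    (forall u v, u \in H -> v \in H -> u \in S -> v \notin S ->
       c v u + (r - 1) / (20 * N%:R ^+ 2) <= x * c u v) ->
    (forall u, u \notin H -> u \in S -> s u \notin S ->
       c (s u) u <= 1 /\ 20 / 21 <= c u (s u)) ->
    (forall u v, [disjoint S & H] -> j \in S -> s j \in S ->
       (j == u) || (j == s u) -> v \in H -> 10 * c v u <= (1 - x) * c u v) ->
    (forall u v, H \subset S -> u \in H -> v \notin H -> v \notin S -> s v \notin S ->
       x ^+ #|H|.-1 * c v u <= 24 / 25 * th * c u v) ->
  0 <= cut_drift c (potential H s x th j) S.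
Proof.
move=> jH c0 c_far c_ext c_hub c_pair c_seed c_guard.
have [x0 x1 x2] := hub_ratio_bounds; have [th0 thN th1] := th_bounds.
have H0 : (0 < #|H|)%N by apply: leq_trans H4.
have dg := d_guard; have r1 := r_gt1.
apply: (@drift_ge0 R N H s x th j sK sH s_neq x0 x1 th0 thN H0 jH S c
  (20 * d / (1 - x)) ((r - 1) / (20 * N%:R ^+ 2)) 100^-1) => //.
- by rewrite divr_ge0 ?mulr_ge0 ?(ltW d_gt0) //; lra.
- by rewrite divr_ge0 ?mulr_ge0 ?exprn_ge0 //; lra.
- by lra.
- by move=> u uH uS suS; have [] := c_pair u uH uS suS; lra.
- move=> u v dis jS sjS ju vH; have := c_seed u v dis jS sjS ju vH.
  by have := c0 v u; lra.
Qed.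

Lemma ext_rate_le (f D : R) : 0 <= f -> f <= r -> (1 - x) / 10 <= D ->
  f * d / D <= 20 * d / (1 - x).
Proof.
move=> f0 fr DD; have [x0 x1 x2] := hub_ratio_bounds.
have d0 := d_gt0; have r2 := r_lt.
have h : f * d / D <= f * d / ((1 - x) / 10).
  by apply: ratio_le => //; [rewrite mulr_ge0 // ltW|lra].
apply: le_trans h _; rewrite invf_div mulrA ler_wpM2r ?invr_ge0; [lra|nra|].
by nra.
Qed.

Lemma wheel_w_hub u v : u \in H -> v \in H -> u != v -> wheel_w u v = 1.
Proof. by rewrite /wheel_w => -> -> ->. Qed.

Lemma wheel_w_spoke u v : (u \in H) != (v \in H) -> wheel_w u v = d.
Proof. by rewrite /wheel_w; case: (u \in H); case: (v \in H). Qed.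

Lemma wheel_w_pair u : u \notin H -> wheel_w u (s u) = b u.
Proof. by rewrite /wheel_w sH => /negbTE ->; rewrite eqxx mul1r. Qed.

Lemma wheel_w_pairC u : u \notin H -> wheel_w (s u) u = b u.
Proof. by move=> uH; have [-> _ _] := wheel_weighted; exact: wheel_w_pair. Qed.

Lemma wheel_w_far u v : u \notin H -> v \notin H -> v != s u -> wheel_w u v = 0.
Proof. by rewrite /wheel_w => /negbTE -> /negbTE -> /negbTE ->; rewrite mul0r. Qed.

Lemma fitS S u : u \in S -> fit r S u = r.
Proof. by rewrite /fit => ->. Qed.

Lemma fitNS S u : u \notin S -> fit r S u = 1.
Proof. by rewrite /fit => /negbTE ->. Qed.

Lemma Bd_drift j S : j \notin H -> b j = (1 - x) / 10 ->
  0 <= cut_drift (rate_Bd wheel_w r S) (potential H s x th j) S.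
Proof.
move=> jH bj; have [x0 x1 x2] := hub_ratio_bounds.
have [h4 n0 hn dh dn] := wheel_sizes; have d0 := d_gt0.
have r1 := r_gt1; have r2 := r_lt; have rx := hub_ratioE.
have w0 := wheel_weighted; have dg := wheel_deg_gt0.
have N4 : 4 <= N%:R :> R by lra.
have N0 : 0 < N%:R :> R by lra.
have y0 : 0 < 1 - x by rewrite subr_gt0.
have dn0 : 0 <= d * n by rewrite mulr_ge0 ?(ltW d0).
have dh0 : 0 <= d * h by rewrite mulr_ge0 ?(ltW d0).
have D_ge : 3 <= h - 1 + d * n by lra.
have D_le : h - 1 + d * n <= N%:R by lra.
have D0 : 0 < h - 1 + d * n by lra.
apply: wheel_drift => //.
- move=> u v; rewrite divr_ge0 ?(ltW (dg _)) // mulr_ge0 ?(ltW (fit_gt0 _ _ _)) //.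
  by have [_ ->] := w0.
- by move=> u v uH vH uv; rewrite /rate_Bd wheel_w_far // mulr0 mul0r.
- move=> u v uv; rewrite /rate_Bd wheel_w_spoke //.
  apply: ext_rate_le; [exact/ltW/fit_gt0|exact: fit_le|].
  have [uH|uH] := boolP (u \in H); first by rewrite wheel_deg_hub //; lra.
  by rewrite wheel_deg_pair //; have := b_ge u; lra.
- move=> u v uH vH uS vS; have uv : u != v by apply: contraNneq vS => <-.
  rewrite /rate_Bd !wheel_deg_hub // !wheel_w_hub // 1?eq_sym // (fitS uS) (fitNS vS).
  by rewrite !mulr1; apply: hub_edge_Bd => //; lra.
- move=> u uH uS suS.
  rewrite /rate_Bd !wheel_deg_pair ?sH // wheel_w_pair // wheel_w_pairC // bs.
  rewrite (fitS uS) (fitNS suS).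
  have bu := b_ge u; have E0 : 0 < d * h + b u by lra.
  by split; [rewrite ler_pdivrMr //; lra|rewrite ler_pdivlMr //; nra].
- move=> u v dis jS sjS ju vH.
  have vS : v \notin S by rewrite (disjointFl dis vH).
  have [uH uS bu] : [/\ u \notin H, u \in S & b u = (1 - x) / 10].
    case/orP: ju => /eqP e; first by rewrite -e.
    by move: jH jS sjS bj; rewrite e sH sK bs.
  have uv : (u \in H) != (v \in H) by rewrite vH (negbTE uH).
  have vu : (v \in H) != (u \in H) by rewrite eq_sym.
  rewrite /rate_Bd (wheel_deg_hub vH) (wheel_deg_pair uH) !wheel_w_spoke //.
  rewrite (fitS uS) (fitNS vS) bu.
  by apply: seed_edge_Bd => //; lra.
- move=> u v HS uH vH vS svS.
  have uS : u \in S by apply: (subsetP HS).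
  have uv : (u \in H) != (v \in H) by rewrite uH (negbTE vH).
  have vu : (v \in H) != (u \in H) by rewrite eq_sym.
  rewrite /rate_Bd (wheel_deg_hub uH) (wheel_deg_pair vH) !wheel_w_spoke //.
  rewrite (fitS uS) (fitNS vS) mul1r.
  have X0 : 0 <= x ^+ #|H|.-1 by rewrite exprn_ge0 // ltW.
  have NL := N_large; have bv := b_ge v.
  by apply: (@guard_edge_Bd R r (1 - x)) => //; lra.
Qed.

Lemma dB_drift j S : j \notin H -> b j = 10 * h / (1 - x) ->
  0 <= cut_drift (rate_dB wheel_w r S) (potential H s x th j) S.
Proof.
move=> jH bj; have [x0 x1 x2] := hub_ratio_bounds.
have [h4 n0 hn dh dn] := wheel_sizes; have d0 := d_gt0.
have r1 := r_gt1; have r2 := r_lt; have rx := hub_ratioE.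
have w0 := wheel_weighted; have dg := wheel_deg_gt0.
have N4 : 4 <= N%:R :> R by lra.
have N0 : 0 < N%:R :> R by lra.
have y0 : 0 < 1 - x by rewrite subr_gt0.
have dn0 : 0 <= d * n by rewrite mulr_ge0 ?(ltW d0).
have dh0 : 0 <= d * h by rewrite mulr_ge0 ?(ltW d0).
pose fH := \sum_(u in H) fit r S u; pose fE := \sum_(u in ~: H) fit r S u.
have /andP[fH1 fH2] : h <= fH <= r * h by exact: sum_fit_bounds.
have /andP[fE1 fE2] : n <= fE <= r * n by exact: sum_fit_bounds.
have dfE0 : 0 <= d * fE by nra.
have dfE : d * fE <= 100^-1 by nra.
have dfH0 : 0 <= d * fH by nra.
have dfH : d * fH <= r * ((1 - x) / 200) by nra.
have den_hub v : v \in H ->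
    \sum_y fit r S y * wheel_w y v = fH - fit r S v + d * fE.
  by move=> vH; rewrite wheel_sum_hub.
have den_pair v : v \notin H ->
    \sum_y fit r S y * wheel_w y v = d * fH + fit r S (s v) * b v.
  by move=> vH; rewrite wheel_sum_pair.
have f1 u : 1 <= fit r S u by exact: fit_ge1.
have f2 u : fit r S u <= r by exact: fit_le.
apply: wheel_drift => //.
- move=> u v; rewrite divr_ge0 ?(ltW (sum_fitw_gt0 _ _ _ _ _)) //.
  by rewrite mulr_ge0 ?(ltW (fit_gt0 _ _ _)) //; have [_ ->] := w0.
- by move=> u v uH vH uv; rewrite /rate_dB wheel_w_far // mulr0 mul0r.
- move=> u v uv; rewrite /rate_dB wheel_w_spoke //.
  apply: ext_rate_le; [exact/ltW/fit_gt0|exact: fit_le|].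
  have fv := f2 v; have [vH|vH] := boolP (v \in H); first by rewrite den_hub //; lra.
  by rewrite den_pair //; have := b_ge v; have := f1 (s v); nra.
- move=> u v uH vH uS vS; have uv : u != v by apply: contraNneq vS => <-.
  rewrite /rate_dB !den_hub // !wheel_w_hub // 1?eq_sym // (fitS uS) (fitNS vS) !mulr1.
  have T1 : 4 <= fH + d * fE by lra.
  have T2 : fH + d * fE <= 2 * N%:R by nra.
  by rewrite ![fH - _ + _]addrAC; exact: hub_edge_dB.
- move=> u uH uS suS.
  rewrite /rate_dB !den_pair ?sH // sK bs wheel_w_pair // wheel_w_pairC //.
  rewrite (fitS uS) (fitNS suS).
  have bu := b_ge u.
  by split; [rewrite ler_pdivrMr; lra|rewrite ler_pdivlMr; nra].
- move=> u v dis jS sjS ju vH.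
  have vS : v \notin S by rewrite (disjointFl dis vH).
  have [uH uS suS bu] : [/\ u \notin H, u \in S, s u \in S & b u = 10 * h / (1 - x)].
    case/orP: ju => /eqP e; first by rewrite -e.
    by move: jH jS sjS bj; rewrite e sH sK bs.
  have uv : (u \in H) != (v \in H) by rewrite vH (negbTE uH).
  have vu : (v \in H) != (u \in H) by rewrite eq_sym.
  have fHE : fH = h.
    rewrite -sumr_const; apply: eq_bigr => y yH.
    by rewrite fitNS // (disjointFl dis yH).
  rewrite /rate_dB (den_hub _ vH) (den_pair _ uH) !wheel_w_spoke //.
  rewrite !(fitS uS) (fitS suS) !(fitNS vS) bu.
  have h0 : 0 < h by lra.
  have b0 : 0 < 10 * h / (1 - x) by rewrite divr_gt0 // mulr_gt0.
  apply: (@seed_edge_dB R r (1 - x) d h) => //; [|lra|lra].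
  by rewrite ler_wpDl // ler_peMl // ltW.
- move=> u v HS uH vH vS svS.
  have uS : u \in S by apply: (subsetP HS).
  have uv : (u \in H) != (v \in H) by rewrite uH (negbTE vH).
  have vu : (v \in H) != (u \in H) by rewrite eq_sym.
  rewrite /rate_dB (den_hub _ uH) (den_pair _ vH) !wheel_w_spoke //.
  rewrite !(fitS uS) !(fitNS vS) (fitNS svS) !mul1r.
  have X0 : 0 <= x ^+ #|H|.-1 by rewrite exprn_ge0 // ltW.
  have NL := N_large; have bv := b_ge v; have bv2 := b_le v.
  have E : 10 * h / (1 - x) + 1 <= 11 * N%:R / (1 - x).
    have y_neq0 : 1 - x != 0 by rewrite subr_eq0 gt_eqF.
    have -> : 10 * h / (1 - x) + 1 = (10 * h + (1 - x)) / (1 - x).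
      by rewrite [RHS]mulrDl divff.
    by rewrite ler_wpM2r ?invr_ge0; lra.
  by apply: (@guard_edge_dB R r (1 - x)) => //; lra.
Qed.

Lemma rho_from_Bd_wheel j : j \notin H -> b j = (1 - x) / 10 ->
  54 / 125 <= rho_from (P_Bd wheel_w r) [set j].
Proof.
move=> jH bj; rewrite -(potential_seed jH).
have [x0 x1 _] := hub_ratio_bounds; have [th0 thN _] := th_bounds.
have H0 : (0 < #|H|)%N by apply: leq_trans H4.
apply: (rho_from_Bd_ge wheel_weighted wheel_deg_gt0 r_gt1 _ _ wheel_connected).
- exact: leq_trans (ltn_ord j).
- exact: potential_set0.
- exact: potential_le1.
- by move=> S; exact: Bd_drift.
Qed.

Lemma rho_from_dB_wheel j : j \notin H -> b j = 10 * h / (1 - x) ->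
  54 / 125 <= rho_from (P_dB wheel_w r) [set j].
Proof.
move=> jH bj; rewrite -(potential_seed jH).
have [x0 x1 _] := hub_ratio_bounds; have [th0 thN _] := th_bounds.
have H0 : (0 < #|H|)%N by apply: leq_trans H4.
apply: (rho_from_dB_ge wheel_weighted wheel_deg_gt0 r_gt1 _ _ wheel_connected).
- exact: leq_trans (ltn_ord j).
- exact: potential_set0.
- exact: potential_le1.
- by move=> S; exact: dB_drift.
Qed.

End Wheel.

Lemma rho_ge_share (R : realType) N (P : {set 'I_N} -> {set 'I_N} -> R) c
    (A : {set 'I_N}) (q : R) : rate_kernel P c ->
    (forall j, j \in A -> q <= rho_from P [set j]) ->
  N%:R^-1 * (q * #|A|%:R) <= rho P.
Proof.
move=> Pc Aq; rewrite /rho ler_wpM2l ?invr_ge0 //.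
rewrite mulr_natr -sumr_const [leRHS](bigID [in A]) /= -[leLHS]addr0 lerD ?ler_sum //.
by apply: sumr_ge0 => j _; exact: rho_from_ge0_rate Pc _.
Qed.

(** * Choice of the parameters *)

Definition flip (k : nat) : nat := if (k %% 2 == 0)%N then k.+1 else k.-1.

Lemma flipK : involutive flip.
Proof. by move=> k; rewrite /flip; have [e|e] := eqVneq (k %% 2)%N 0%N; case: ifP; lia. Qed.

Lemma flip_neq k : flip k != k.
Proof. by rewrite /flip; have [e|e] := eqVneq (k %% 2)%N 0%N; lia. Qed.

Lemma flip_ltn k a : (flip k < 2 * a)%N = (k < 2 * a)%N.
Proof.
by rewrite /flip; have [e|e] := eqVneq (k %% 2)%N 0%N; apply/idP/idP; lia.
Qed.

Definition mate N m (u : 'I_N) : 'I_N :=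
  if (u < 2 * (2 * m))%N then insubd u (flip u) else u.

Definition wheel_hub N m : {set 'I_N} := [set u : 'I_N | (2 * (2 * m) <= u)%N].

Section Indexing.
Variables (N m : nat).
Hypothesis mN : (2 * (2 * m) <= N)%N.
Implicit Types u : 'I_N.

Lemma mateE u : mate m u = (if (u < 2 * (2 * m))%N then flip u else u) :> nat.
Proof.
rewrite /mate; case: ifP => // um; rewrite val_insubd.
by rewrite (leq_trans _ mN) // flip_ltn.
Qed.

Lemma mate_ltn u : (mate m u < 2 * (2 * m))%N = (u < 2 * (2 * m))%N.
Proof. by rewrite mateE; case: ifP => um; rewrite ?flip_ltn um. Qed.

Lemma mate_ltn_half u : (mate m u < 2 * m)%N = (u < 2 * m)%N.
Proof. by rewrite mateE; case: ifP => um; rewrite ?flip_ltn. Qed.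

Lemma mateK : involutive (@mate N m).
Proof.
move=> u; apply: val_inj; rewrite /= mateE mate_ltn mateE.
by case: (u < _)%N => //; rewrite flipK.
Qed.

Lemma mate_hub u : (mate m u \in wheel_hub N m) = (u \in wheel_hub N m).
Proof. by rewrite !inE leqNgt mate_ltn -leqNgt. Qed.

Lemma mate_neq u : u \notin wheel_hub N m -> mate m u != u.
Proof. by rewrite inE -ltnNge -(inj_eq val_inj) /= mateE => ->; rewrite flip_neq. Qed.

Lemma card_ord_lt k : (k <= N)%N -> #|[set u : 'I_N | (u < k)%N]| = k.
Proof.
move=> kN; rewrite -sum1_card (eq_bigl (fun u : 'I_N => (u < k)%N)); last first.
  by move=> u; rewrite inE.
by rewrite (big_ord_narrow kN) sum1_card card_ord.
Qed.

Lemma card_wheel_hub : #|wheel_hub N m| = (N - 2 * (2 * m))%N.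
Proof.
have -> : wheel_hub N m = ~: [set u : 'I_N | (u < 2 * (2 * m))%N].
  by apply/setP => u; rewrite !inE -leqNgt.
by rewrite cardsCs setCK card_ord card_ord_lt.
Qed.

Lemma card_second_half :
  #|[set u : 'I_N | (2 * m <= u < 2 * (2 * m))%N]| = (2 * m)%N.
Proof.
have -> : [set u : 'I_N | (2 * m <= u < 2 * (2 * m))%N] =
    [set u : 'I_N | (u < 2 * (2 * m))%N] :\: [set u : 'I_N | (u < 2 * m)%N].
  by apply/setP => u; rewrite !inE -leqNgt.
rewrite cardsDS ?card_ord_lt //; [lia|have := mN; lia|].
by apply/subsetP => u; rewrite !inE; lia.
Qed.

End Indexing.

Lemma mul_expr_le1 (R : realType) (x : R) k : 0 <= x -> x <= 1 ->
  k%:R * (1 - x) * x ^+ k <= 1.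
Proof.
move=> x0 x1; suff : k%:R * (1 - x) * x ^+ k <= 1 - x ^+ k.
  by have := exprn_ge0 k x0; lra.
elim: k => [|k IH]; first by rewrite !mul0r expr0 subrr.
have X0 := exprn_ge0 k x0; have X1 := exprn_ile1 k x0 x1.
rewrite -natr1 exprS; set X := x ^+ k in IH X0 X1 *; set K := k%:R in IH *.
have h1 : x * (K * (1 - x) * X) <= x * (1 - X) by rewrite ler_wpM2l.
have h2 : 0 <= (1 - x) * (1 - x * X) by apply: mulr_ge0; nra.
by lra.
Qed.

Lemma sqr_expr_small (R : realType) (x : R) : 0 < x -> x < 1 ->
  exists N0, forall N l, (N0 <= N)%N -> (3 * (N %/ 40) <= l)%N ->
    250 * N%:R ^+ 2 * x ^+ l <= 1 - x.
Proof.
move=> x0 x1; have [B B0 BE] : exists2 B : R, 0 <= B & 250 * 80 ^+ 2 = B.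
  by exists (250 * 80 ^+ 2) => //; apply: mulr_ge0 => //; exact: exprn_ge0.
pose C : R := B / (1 - x) ^+ 4.
have y0 : 0 < (1 - x) ^+ 4 by rewrite exprn_gt0 // subr_gt0.
have C0 : 0 <= C by rewrite divr_ge0 // ltW.
exists (40 * (Num.bound C).+1)%N => N l NN0; set k := (N %/ 40)%N => kl.
have kC : C < k%:R.
  by apply: lt_le_trans (archi_boundP C0) _; rewrite ler_nat /k; lia.
have Nk : N%:R <= 80 * k%:R :> R.
  by rewrite -[80]/(80%:R) -natrM ler_nat /k; lia.
have k0 : 0 <= k%:R :> R by rewrite ler0n.
have xl : x ^+ l <= x ^+ (3 * k) by rewrite ler_wiXn2l ?ltW.
have kx := mul_expr_le1 k (ltW x0) (ltW x1).
have cube : k%:R ^+ 3 * (1 - x) ^+ 3 * x ^+ (3 * k) <= 1.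
  have -> : k%:R ^+ 3 * (1 - x) ^+ 3 * x ^+ (3 * k) = (k%:R * (1 - x) * x ^+ k) ^+ 3.
    by rewrite !exprMn -exprM mulnC.
  by rewrite exprn_ile1 // !mulr_ge0 ?exprn_ge0 ?subr_ge0 ?(ltW x0) ?(ltW x1).
have N2 : 250 * N%:R ^+ 2 <= B * k%:R ^+ 2 :> R.
  by rewrite -BE -mulrA -exprMn ler_wpM2l // lerXn2r // nnegrE // mulr_ge0.
apply: (@le_trans _ _ (B * k%:R ^+ 2 * x ^+ (3 * k))).
  by apply: ler_pM => //; rewrite ?mulr_ge0 ?exprn_ge0 // ltW.
rewrite -(ler_pM2r (_ : 0 < k%:R * (1 - x) ^+ 3)); last first.
  by rewrite mulr_gt0 ?exprn_gt0 ?subr_gt0 //; exact: le_lt_trans kC.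
have -> : (1 - x) * (k%:R * (1 - x) ^+ 3) = k%:R * (1 - x) ^+ 4 by ring.
apply: (@le_trans _ _ B); last by rewrite -ler_pdivrMr // ltW.
have -> : B * k%:R ^+ 2 * x ^+ (3 * k) * (k%:R * (1 - x) ^+ 3) =
  B * (k%:R ^+ 3 * (1 - x) ^+ 3 * x ^+ (3 * k)) by ring.
by rewrite ler_piMr.
Qed.

Lemma complete_bound_lt (R : realType) (r y rhoK rhoA : R) : 1 < r -> r < 6 / 5 ->
  y <= 3 / 100 -> rhoK <= (1 - r^-1) / (1 - y) -> 18 / 100 <= rhoA ->
  rhoA > 104 / 100 * rhoK.
Proof.
move=> r1 r2 y_le K A.
have r0 : r * r^-1 = 1 by rewrite mulfV // gt_eqF //; lra.
have ri : 1 - r^-1 < 6^-1 by nra.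
have : (1 - r^-1) / (1 - y) <= 6^-1 / (97 / 100).
  apply: ler_pM; [nra|rewrite invr_ge0; lra|lra|].
  by rewrite lef_pV2 ?posrE; lra.
by lra.
Qed.

Theorem theorem4 (R : realType) (r : R) (hr1 : 1 < r) (hr2 : r < 6 / 5) :
  exists N0 : nat, forall N : nat, (N0 <= N)%N ->
    exists w : 'I_N -> 'I_N -> R,
      [/\ weighted_graph w, connected_graph w,
          rho_Bd w r > 104 / 100 * rho_Bd (@complete_w R N) r
        & rho_dB w r > 104 / 100 * rho_dB (@complete_w R N) r].
Proof.
have [x0 x1 x2] := hub_ratio_bounds hr1 hr2; set x := hub_ratio r in x0 x1 x2 *.
have [N1 N1P] := sqr_expr_small x0 x1; exists (N1 + 60)%N => N NN.
have N0' : (0 < N)%N by lia.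
have N1' : (1 < N)%N by lia.
pose m := (9 * N %/ 40)%N; have mN : (2 * (2 * m) <= N)%N by rewrite /m; lia.
have m2N : (2 * m <= N)%N by rewrite /m; lia.
have m_ge : (5 * N <= 12 * (2 * m))%N by rewrite /m; lia.
pose H := wheel_hub N m; have cardH : #|H| = (N - 2 * (2 * m))%N by exact: card_wheel_hub.
have N60 : 60 <= N%:R :> R by rewrite -[60]/(60%:R) ler_nat; lia.
have H4 : (3 < #|H|)%N by rewrite cardH /m; lia.
have N_large : 250 * N%:R ^+ 2 * x ^+ #|H|.-1 <= 1 - x.
  by apply: N1P; rewrite ?cardH /m; lia.
have h4 : 4 <= #|H|%:R :> R by rewrite -[4]/(4%:R) ler_nat.
pose b1 : R := (1 - x) / 10; pose b2 : R := 10 * #|H|%:R / (1 - x).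
have b1_gt0 : 0 < b1 by rewrite divr_gt0 ?subr_gt0.
have b12 : b1 <= b2 by rewrite ler_pdivlMr ?subr_gt0 // /b1; nra.
pose b (u : 'I_N) := if (u < 2 * m)%N then b1 else b2.
have b_ge u : b1 <= b u by rewrite /b; case: ifP.
have b_le u : b u <= b2 by rewrite /b; case: ifP.
have b_gt0 u : 0 < b u by exact: lt_le_trans (b_ge u).
have bs u : b (mate m u) = b u by rewrite /b mate_ltn_half.
pose e1 := (1 - x) / 10 / (20 * N%:R); pose K := N%:R ^+ 2 * 20 / (1 - x).
pose e2 := 20^-1 * (1 - x) * x ^+ #|H| * ((r - 1) / (20 * N%:R ^+ 2)) / K.
pose e3 := 2 * (20 * N%:R)^-1 * 100^-1 / K.
have N0 : 0 < N%:R :> R by lra.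
have NN0 : 0 < N%:R ^+ 2 :> R by rewrite exprn_gt0.
have y0 : 0 < 1 - x by lra.
have K0 : 0 < K by rewrite divr_gt0 // mulr_gt0.
have [d [d0 d1 d2 d3]] : exists d : R, [/\ 0 < d, d <= e1, d <= e2 & d <= e3].
  have e1_gt0 : 0 < e1 by rewrite !divr_gt0 // mulr_gt0.
  have e2_gt0 : 0 < e2.
    rewrite divr_gt0 // mulr_gt0 //; first by rewrite !mulr_gt0 ?exprn_gt0.
    by rewrite divr_gt0 ?subr_gt0 // mulr_gt0.
  have e3_gt0 : 0 < e3 by rewrite divr_gt0 // !mulr_gt0 ?invr_gt0 // mulr_gt0.
  exists (Num.min e1 (Num.min e2 e3)).
  by rewrite !lt_min !ge_min !lexx !orbT e1_gt0 e2_gt0 e3_gt0.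
have d_pair : 20 * (N%:R * d) <= (1 - x) / 10.
  by rewrite mulrA mulrC -ler_pdivlMr // mulr_gt0.
have KE : N%:R ^+ 2 * (20 * d / (1 - x)) = d * K by rewrite /K; ring.
have d_hub : N%:R ^+ 2 * (20 * d / (1 - x)) <=
    20^-1 * (1 - x) * x ^+ #|H| * ((r - 1) / (20 * N%:R ^+ 2)).
  by rewrite KE -ler_pdivlMr.
have d_guard : N%:R ^+ 2 * (20 * d / (1 - x)) <= 2 * (20 * N%:R)^-1 * 100^-1.
  by rewrite KE -ler_pdivlMr.
have sK := @mateK N m mN; have sH := @mate_hub N m mN; have s_neq := @mate_neq N m mN.
have H2 : (1 < #|H|)%N by apply: leq_trans H4.
exists (wheel_w H (mate m) b d).
have W := wheel_weighted sK s_neq bs b_gt0 d0.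
have D := wheel_deg_gt0 sK sH s_neq bs b_gt0 d0 H2.
have share : 18 / 100 <= N%:R^-1 * (54 / 125 * (2 * m)%:R) :> R.
  rewrite ler_pdivlMl //.
  have : (5 * N)%:R <= (12 * (2 * m))%:R :> R by rewrite ler_nat.
  by rewrite !natrM; lra.
have y_le : r^-1 ^+ N <= 3 / 100.
  apply: (@le_trans _ _ (x ^+ #|H|.-1)).
    apply: (@le_trans _ _ (x ^+ N)).
      rewrite lerXn2r ?nnegrE ?invr_ge0 ?ltW //; first lra.
      have := hub_ratioE hr1; rewrite -/x => rx.
      by rewrite -[_^-1]mul1r ltr_pdivrMr; lra.
    by rewrite ler_wiXn2l ?ltW // (leq_trans (leq_pred _)) // cardH leq_subr.
  have X0 : 0 <= x ^+ #|H|.-1 by rewrite exprn_ge0 // ltW.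
  by nra.
split.
- exact: W.
- exact: (wheel_connected sK s_neq bs b_gt0 d0 H2).
- apply: (complete_bound_lt hr1 hr2 y_le (rho_Bd_complete_le N1' hr1)).
  apply: le_trans share _; rewrite -(card_ord_lt m2N).
  apply: (rho_ge_share (rate_kernel_Bd W D hr1 N0')) => j; rewrite inE => jm.
  apply: (rho_from_Bd_wheel sK sH s_neq bs b_gt0 d0 H2 hr1 hr2 H4) => //.
    by rewrite inE -ltnNge (leq_trans jm) // leq_pmull.
  by rewrite /b jm.
- apply: (complete_bound_lt hr1 hr2 y_le (rho_dB_complete_le N1' hr1)).
  apply: le_trans share _; rewrite -(card_second_half mN).
  apply: (rho_ge_share (rate_kernel_dB W D hr1 N0')) => j; rewrite inE => /andP[mj jm].
  apply: (rho_from_dB_wheel sK sH s_neq bs b_gt0 d0 H2 hr1 hr2 H4) => //.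
    by rewrite inE -ltnNge.
  by rewrite /b ltnNge mj.
Qed.
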